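(* Let $c_\lambda$ be the coefficient of $e_\lambda z^{|\lambda|}$ in $\mathcal{X}_{P_{v,w}}(z):=\sum_{n\ge 3}X_{P_{n,v,w}}z^{n+2}$, i.e. $\mathcal{X}_{P_{v,w}}(z)=\sum_\lambda c_\lambda e_\lambda z^{|\lambda|}$. Then: (a) for $k\ge 3$, $c_{(k+2)}=4(k+2)$, $c_{(k,2)}=4(k-2)$, and $c_{(k+1,1)}=4k$; (b) for $i\ge 3$, $c_{(i,i)}=4(i-1)i$, and for $i,j\ge 3$ with $i\ne j$, $c_{(i,j)}=4(j-1)i+4(i-1)j$; (c) $c_{(i,i,1)}=4(i-1)^2$ for $i\ge 3$, $c_{(i,j,1)}=8(i-1)(j-1)$ for $i,j\ge 3$ with $i\ne j$, and $c_{(i,j,1)}=0$ otherwise (i.e. whenever $\min(i,j)\le 2$); (d) if $c_{1\cup\mu}\ne 0$, then $1$ is not a part of $\mu$; (e) for all $k\ge 0$, $c_{(3^2,2^{k+1})}=32$ and $c_{(3^2,2^{k+1},1)}=16$.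
   Context: The chromatic symmetric function of a finite simple graph $H=(V,E)$ is $X_H=\sum_\kappa\prod_{u\in V}x_{\kappa(u)}$, the sum over all proper colorings $\kappa:V\to\mathbb{Z}_{>0}$. $P_n$ is the path on $n$ vertices. The twin of a graph at a vertex $v$ is obtained by adding a new vertex $v'$ joined to $v$ and to all neighbors of $v$. $P_{n,v,w}$ denotes $P_n$ twinned at its two leaves $v$ and $w$ in succession. $e_\lambda$ are the elementary symmetric functions indexed by partitions $\lambda$; the subscripts of $c$ denote partitions via their multiset of parts (order irrelevant), $a^m$ denotes $m$ parts equal to $a$, and $1\cup\mu$ is $\mu$ with an extra part $1$. *)

(* Defs.v *)
From HB Require Import structures.
From mathcomp Require Import all_boot all_order all_algebra.
From mathcomp Require Import mpoly.

Set Implicit Arguments.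
Unset Strict Implicit.
Unset Printing Implicit Defensive.

Import GRing.Theory.
Local Open Scope ring_scope.

Record sgraph := SGraph {
  vertex :> finType;
  edge : rel vertex;
  edge_sym : ssrbool.symmetric edge;
  edge_irr : irreflexive edge }.

Section Path.
Variable n : nat.

Definition path_edge : rel 'I_n :=
  [rel i j : 'I_n | (i.+1 == j :> nat) || (j.+1 == i :> nat)].

Lemma path_edge_sym : ssrbool.symmetric path_edge.
Proof. by move=> i j; rewrite /path_edge /= orbC. Qed.

Lemma path_edge_irr : irreflexive path_edge.
Proof. by move=> i; rewrite /path_edge /= orbb eqn_leq ltnn. Qed.

Definition path_graph : sgraph := SGraph path_edge_sym path_edge_irr.

End Path.

Section Twin.
Variables (G : sgraph) (v : G).

(* [None] is the new vertex. *)
Definition twin_edge : rel (option G) := fun x y =>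
  match x, y with
  | Some a, Some b => edge a b
  | Some a, None | None, Some a => (a == v) || edge v a
  | None, None => false
  end.

Lemma twin_edge_sym : ssrbool.symmetric twin_edge.
Proof. by case=> [a|] [b|] //=; rewrite edge_sym. Qed.

Lemma twin_edge_irr : irreflexive twin_edge.
Proof. by case=> [a|] //=; rewrite edge_irr. Qed.

Definition twin : sgraph := SGraph twin_edge_sym twin_edge_irr.

End Twin.

(* The path with n vertices twinned at its end 0, then at its end n - 1;
   the value at n = 0 is junk. *)
Definition path_twin (n : nat) : sgraph :=
  if n is n'.+1 then
    @twin (@twin (path_graph n'.+1) ord0) (Some (ord_max : 'I_n'.+1))
  else path_graph 0.

(* A symmetric function in x_0, x_1, ... is given by its images in
   Z[x_0, ..., x_(N-1)] for all N, obtained by setting x_i = 0 for i >= N. *)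
Definition symfun : Type := forall N : nat, {mpoly int[N]}.

Definition proper_coloring (G : sgraph) (N : nat) (k : {ffun G -> 'I_N}) :=
  [forall u : G, forall v : G, edge u v ==> (k u != k v)].

Definition chromatic_symfun (G : sgraph) : symfun := fun N =>
  \sum_(k : {ffun G -> 'I_N} | proper_coloring k) \prod_(u : G) 'X_(k u).

Definition is_intpart (s : seq nat) : bool := sorted geq s && (0%N \notin s).

Record intpart := IntPart { parts :> seq nat; _ : is_intpart parts }.

HB.instance Definition _ := [isSub for parts].
HB.instance Definition _ := [Choice of intpart by <:].

Fact mkintpart_subproof (s : seq nat) :
  is_intpart (sort geq [seq i <- s | 0 < i]%N).
Proof.
rewrite /is_intpart sort_sorted; last by move=> x y; exact: leq_total.
by rewrite mem_sort mem_filter.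
Qed.

(* The partition whose multiset of parts is that of the nonzero entries of s. *)
Definition mkintpart (s : seq nat) : intpart := IntPart (mkintpart_subproof s).

Lemma perm_mkintpart (s : seq nat) : 0%N \notin s -> perm_eq (mkintpart s) s.
Proof.
move=> s0; rewrite /= perm_sort (_ : filter _ _ = s) //.
by apply/all_filterP/allP => x xs; rewrite lt0n; apply: contraNneq s0 => <-.
Qed.

Definition intparts (m : nat) : seq intpart :=
  [seq l : intpart <- undup [seq mkintpart [seq val i | i <- t] | t : m.-tuple 'I_m.+1]
    | sumn l == m].

Lemma uniq_intparts (m : nat) : uniq (intparts m).
Proof. by rewrite filter_uniq ?undup_uniq. Qed.

Lemma mkintpartK (l : intpart) : mkintpart l = l.
Proof.
apply: val_inj => /=; case: l => s /= /andP[ss s0].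
rewrite (_ : filter _ _ = s).
  by apply: sorted_sort => // x y z /= yx xz; apply: leq_trans xz yx.
by apply/all_filterP/allP => x xs; rewrite lt0n; apply: contraNneq s0 => <-.
Qed.

Lemma mem_intparts (m : nat) (l : intpart) : (l \in intparts m) = (sumn l == m).
Proof.
rewrite mem_filter andb_idr // mem_undup => /eqP lm.
have le_sz : (size l <= m)%N.
  case: l lm => s /= /andP[_ s0] <-; elim: s s0 => //= x s IHs.
  by rewrite inE negb_or eq_sym -lt0n => /andP[x0 /IHs]; rewrite -add1n; apply: leq_add.
have le_m x : x \in parts l -> (x <= m)%N.
  rewrite -lm; elim: (parts l) => //= y s IHs; rewrite inE => /orP[/eqP->|/IHs].
    exact: leq_addr.
  by move=> xs; apply: leq_trans xs (leq_addl _ _).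
pose s := [seq (inord x : 'I_m.+1) | x <- l] ++ nseq (m - size l) ord0.
have sz_s : size s == m by rewrite size_cat size_map size_nseq subnKC.
apply/imageP; exists (Tuple sz_s) => //=.
rewrite -[LHS]mkintpartK; apply: val_inj => /=; congr sort.
rewrite map_cat filter_cat map_nseq.
rewrite [X in _ ++ X](_ : _ = [::]) ?cats0; last by elim: (m - _)%N.
rewrite -map_comp (_ : map _ _ = parts l) //.
rewrite -[RHS]map_id; apply/eq_in_map => x /le_m xm /=.
by rewrite inordK.
Qed.

Definition elem_symfun (l : intpart) : symfun := fun N =>
  \prod_(i <- l) mesym N int i.

(* The formal power series F(z), with F m the coefficient of z^m, equals the
   sum over all partitions l of c_l e_l z^|l|. *)
Definition e_expansion (F : nat -> symfun) (c : intpart -> int) : Prop :=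
  forall m N : nat, F m N = \sum_(l <- intparts m) c l *: elem_symfun l N.

(* The sum over n >= 3 of X_(P_(n,v,w)) z^(n+2). *)
Definition path_twin_gf : nat -> symfun := fun m N =>
  if (5 <= m)%N then chromatic_symfun (path_twin (m - 2)) N else 0.

(* Main.v *)
(** Let [M] be the operator [(M f) a = \sum_(b != a) x_b f b] on functions of a
    color, self-adjoint for [<f, g> = \sum_a x_a f a g a], and let
    [W_n = <1, M^(n-1) 1>], the chromatic function of the path on [n] vertices.
    A leaf edge closed into a triangle contributes the weight
    [u = 2 M^2 1 - W_2], so the doubly twinned path with [m = n + 2] vertices has
    [X = <u, M^(m-5) u> = 4 W_m - 4 W_2 W_(m-2) + W_2^2 W_(m-4)], where
    [W_2 = 2 e_2].  Summing the geometric recursion for walks over the first color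
    gives [(E - z E') \sum_n W_n z^n = E] with [E = \sum_n e_n z^n], that is
    [W_n = e_n + \sum_(i >= 2) (i - 1) e_i W_(n-i)].  As the [e_i] are
    algebraically independent, the coefficients of [W_n] obey the corresponding
    recursion on partitions, in which one part is removed at a time. *)

Require Import Defs.
From mathcomp Require Import all_boot all_order all_algebra.
From mathcomp Require Import mpoly ring zify.

Set Implicit Arguments.
Unset Strict Implicit.
Unset Printing Implicit Defensive.

Import GRing.Theory.
Local Open Scope ring_scope.

(** * Walks under the transfer operator and their generating series *)

Lemma deriv_prod (R : comNzRingType) (T : eqType) (r : seq T) (F : T -> {poly R}) :
  uniq r ->
  (\prod_(a <- r) F a)^`() = \sum_(a <- r) (F a)^`() * \prod_(b <- r | b != a) F b.
Proof.
elim: r => [|c r IHr] /= => [_|/andP[cr ur]]; first by rewrite !big_nil derivC.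
rewrite !big_cons eqxx derivM IHr //; congr (_ * _ + _).
  rewrite big_seq [RHS]big_seq_cond; apply: eq_bigl => b.
  by case: (boolP (b \in r)) => //= br; rewrite (contraNneq _ cr) // => <-.
rewrite mulr_sumr !big_seq; apply: eq_bigr => a ar.
by rewrite big_cons (contraNneq _ cr) 1?mulrCA // => ->.
Qed.

Section Transfer.
Variables (T : finType) (R : comNzRingType) (x : T -> R).

Definition transfer (f : T -> R) : T -> R := fun a => \sum_(b | b != a) x b * f b.

Definition walk (n : nat) : T -> R := iter n transfer (fun=> 1).

Definition pairing (f g : T -> R) : R := \sum_a x a * f a * g a.

Definition path_sum (n : nat) : R :=
  if n is n'.+1 then \sum_a x a * walk n' a else 1.

(** For a vertex colored [a], this weighs the colorings of the other two vertices of a triangle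
    through it: a leaf and its twin. *)
Definition twin_weight (a : T) : R :=
  \sum_(b | b != a) x b * \sum_(c | (c != b) && (c != a)) x c.

Lemma transfer_eq (f g : T -> R) : f =1 g -> transfer f =1 transfer g.
Proof. by move=> fg a; apply: eq_bigr => b _; rewrite fg. Qed.

Lemma transfer_comb (k l : R) (f g : T -> R) :
  transfer (fun a => k * f a + l * g a) =1
  (fun a => k * transfer f a + l * transfer g a).
Proof.
by move=> a; rewrite !mulr_sumr -big_split; apply: eq_bigr => b _ /=; ring.
Qed.

Lemma pairing_transfer (f g : T -> R) :
  pairing (transfer f) g = pairing f (transfer g).
Proof.
rewrite /pairing /transfer.
under eq_bigr do rewrite mulr_sumr mulr_suml.
under [RHS]eq_bigr do rewrite mulr_sumr.
rewrite (exchange_big_dep xpredT) //=; apply: eq_bigr => b _.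
by apply: eq_big => [a|a _]; [rewrite eq_sym | ring].
Qed.

(** Self-adjointness moves the transfers to the right one at a time, until the left argument is the
    constant 1. *)
Lemma pairing_walk (i j : nat) : pairing (walk i) (walk j) = path_sum (i + j).+1.
Proof.
elim: i j => [|i IHi] j.
  by apply: eq_bigr => a _; rewrite mulr1.
by rewrite pairing_transfer (IHi j.+1) addSnnS.
Qed.

(* Given b != c, the indicator of (b != a and c != a) is
   [b != a] + [c != a] - 1. *)
Lemma twin_weightE (a : T) : twin_weight a = 2 * walk 2 a - path_sum 2.
Proof.
have w2 : walk 2 a = twin_weight a + x a * \sum_(b | b != a) x b.
  rewrite mulr_sumr -big_split; apply: eq_bigr => b ba /=.
  rewrite /transfer (bigD1 a) 1?eq_sym //=.
  by under eq_bigr do rewrite mulr1; ring.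
have -> : path_sum 2 = x a * (\sum_(b | b != a) x b) + walk 2 a.
  rewrite /= (bigD1 a) //=; congr (x a * _ + _).
  by apply: eq_bigr => b _; rewrite mulr1.
by rewrite w2; ring.
Qed.

Lemma iter_transfer_twin_weight (n : nat) :
  iter n transfer twin_weight =1
  (fun a => 2 * walk n.+2 a + - path_sum 2 * walk n a).
Proof.
elim: n => [|n IHn] a; first by rewrite /= twin_weightE mulr1.
by rewrite iterS (transfer_eq IHn) transfer_comb.
Qed.

Lemma pairing_twin_weight (n : nat) :
  pairing twin_weight (iter n transfer twin_weight) =
  4 * path_sum n.+4.+1 - 4 * path_sum 2 * path_sum n.+3
    + path_sum 2 ^+ 2 * path_sum n.+1.
Proof.
have twE := twin_weightE; have itE := iter_transfer_twin_weight n.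
have -> : pairing twin_weight (iter n transfer twin_weight) =
    4 * pairing (walk 2) (walk n.+2)
    - 2 * path_sum 2 * pairing (walk 2) (walk n)
    - 2 * path_sum 2 * pairing (walk 0) (walk n.+2)
    + path_sum 2 ^+ 2 * pairing (walk 0) (walk n).
  move: (path_sum 2) twE itE => q twE itE.
  rewrite /pairing !mulr_sumr -!sumrB -big_split; apply: eq_bigr => a _.
  rewrite twE itE (_ : walk 0 a = 1) //.
  by move: (walk 2 a) (walk n a) (walk n.+2 a) => w2 wn wn2 /=; ring.
by rewrite !pairing_walk !add2n !add0n; ring.
Qed.

Definition elem_gf : {poly R} := \prod_a (1 + x a *: 'X).

(* Writing W_a for the generating series of the walks from a, the recursion
   W_a = x_a z (P - W_a) multiplied by E/(1 + x_a z) and summed over a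
   gives E (P - 1) = z E' P. *)
Lemma elem_gf_path_sum (n : nat) :
  \sum_(i < n.+1) (1 - i%:R) * elem_gf`_i * path_sum (n - i) = elem_gf`_n.
Proof.
(* Power series are cut off after degree [n]: [eqn] is equality modulo X^(n+1), which multiplication
   by a fixed polynomial preserves. *)
pose eqn (p q : {poly R}) := forall k, (k <= n)%N -> p`_k = q`_k.
have eqnM r p q : eqn p q -> eqn (r * p) (r * q).
  move=> pq k kn; rewrite !coefM; apply: eq_bigr => i _; congr (_ * _).
  by apply: pq; apply: leq_trans kn; apply: leq_subr.
pose P := \poly_(i < n.+1) path_sum i.
pose W a := \poly_(i < n.+1) (if i is j.+1 then x a * walk j a else 0).
pose Eh a := \prod_(b | b != a) (1 + x b *: 'X : {poly R}).
have EhE a : elem_gf = Eh a * (1 + x a *: 'X).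
  by rewrite /elem_gf (bigD1 a) //= mulrC.
have PW : eqn (P - 1) (\sum_a W a).
  move=> [|k] kn; rewrite coefB coef_poly coef_sum ltnS kn coef1 /= ?subrr ?subr0.
    by rewrite big1 // => a _; rewrite coef_poly ltnS kn.
  by apply: eq_bigr => a _; rewrite coef_poly ltnS kn.
have Wrec a : eqn ((1 + x a *: 'X) * W a) (x a *: ('X * P)).
  move=> k kn; rewrite mulrDl mul1r -scalerAl coefD !coefZ !coefXM.
  case: k kn => [|[|k]] kn /=; rewrite !coef_poly ?ltnS ?kn ?(ltnW kn) /=.
  - by rewrite !mulr0 addr0.
  - by rewrite mulr0 addr0.
  (* Adding [x a * walk k a] restores the color [a] omitted by [transfer], which completes the sum
     to [path_sum k.+1]. *)
  - by rewrite -mulrDr; congr (_ * _); rewrite [RHS](bigD1 a) //= addrC.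
have dE : elem_gf^`() = \sum_a x a *: Eh a.
  rewrite deriv_prod ?index_enum_uniq //; apply: eq_bigr => a _.
  by rewrite derivD derivC derivZ derivX add0r -scalerAl mul1r.
have main : eqn (elem_gf * (P - 1)) ('X * elem_gf^`() * P).
  move=> k kn; rewrite (eqnM elem_gf _ _ PW) // dE !mulr_sumr mulr_suml.
  rewrite !coef_sum; apply: eq_bigr => a _.
  rewrite (EhE a) -mulrA (eqnM (Eh a) _ _ (Wrec a)) //; congr ((polyseq _)`_k).
  by rewrite -!mul_polyC; ring.
have /eqP := main n (leqnn n).
rewrite mulrBr mulr1 coefB subr_eq addrC -subr_eq => /eqP <-.
rewrite !coefM -sumrB; apply: eq_bigr => i _.
rewrite coef_poly ltnS leq_subr coefXM coef_deriv.
by case: (i : nat) => [|j] /=; rewrite ?mulrS; ring.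
Qed.
End Transfer.

(** * Colorings of the doubly twinned path, summed vertex by vertex *)

Section Colorings.
Variables (N : nat) (R : comNzRingType) (x : 'I_N -> R).

(** Weighs the colors open to the twin of a leaf, when the leaf and its neighbor have the colors [a]
    and [b]. *)
Definition avoid_sum (a b : 'I_N) : R := \sum_(c | (c != a) && (c != b)) x c.

Definition extend_coloring (G : finType) (c : 'I_N) (g : {ffun G -> 'I_N}) :
  {ffun option G -> 'I_N} := [ffun o => if o is Some u then g u else c].

Lemma proper_coloring_twin (G : sgraph) (v : G) (c : 'I_N) (g : {ffun G -> 'I_N}) :
  proper_coloring (extend_coloring c g : {ffun twin v -> 'I_N}) =
  proper_coloring g && ((c != g v) && [forall u, edge v u ==> (c != g u)]).
Proof.
apply/forallP/idP => [pk|/and3P[/forallP pg cv /forallP cN] u].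
  apply/and3P; split.
  - apply/forallP => u; apply/forallP => w; apply/implyP => uw.
    by have /forallP/(_ (Some w))/implyP := pk (Some u); rewrite !ffunE; apply.
  - have /forallP/(_ (Some v))/implyP := pk None.
    by rewrite !ffunE /= eqxx; apply.
  - apply/forallP => u; apply/implyP => vu.
    have /forallP/(_ (Some u))/implyP := pk None.
    by rewrite !ffunE /= vu orbT; apply.
have cvN w : (w == v) || edge v w -> c != g w.
  by move=> /orP[/eqP-> //|]; apply/implyP.
apply/forallP => w; apply/implyP; rewrite !ffunE.
case: u w => [u|] [w|] //=; last exact: cvN.
  by have /forallP/(_ w)/implyP := pg u; apply.
by move=> /cvN; rewrite eq_sym.
Qed.

(** The color of the new vertex is summed last, for a fixed coloring of the old graph. A general [F]
    is carried along so that the lemma can be applied to a twin of a twin. *)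
Lemma sum_proper_coloring_twin (G : sgraph) (v : G) (F : {ffun twin v -> 'I_N} -> R) :
  \sum_(k : {ffun twin v -> 'I_N} | proper_coloring k) (\prod_u x (k u)) * F k =
  \sum_(g : {ffun G -> 'I_N} | proper_coloring g) (\prod_u x (g u)) *
    \sum_(c | (c != g v) && [forall u, edge v u ==> (c != g u)])
      x c * F (extend_coloring c g).
Proof.
under [RHS]eq_bigr do rewrite mulr_sumr.
rewrite pair_big_dep /=.
pose h (p : {ffun G -> 'I_N} * 'I_N) : {ffun twin v -> 'I_N} :=
  extend_coloring p.2 p.1.
rewrite (reindex h) /=; last first.
  exists (fun k : {ffun twin v -> 'I_N} => ([ffun u => k (Some u)], k None)).
    by move=> [g c] _; congr (_, _); rewrite ?ffunE //; apply/ffunP => u; rewrite !ffunE.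
  by move=> k _; apply/ffunP => -[u|]; rewrite !ffunE.
apply: eq_big => [[g c]|[g c] _]; first by rewrite proper_coloring_twin.
rewrite /= mulrA; congr (_ * _); rewrite (bigD1 None) //= ffunE mulrC; congr (_ * _).
rewrite (reindex_omap Some id) => [|[]//]; apply: eq_big => [u|u _].
  by rewrite /= eqxx.
by rewrite ffunE.
Qed.

Definition cons_coloring (n : nat) (a : 'I_N) (g : {ffun 'I_n -> 'I_N}) :
  {ffun 'I_n.+1 -> 'I_N} := [ffun i => oapp g a (unlift ord0 i)].

Lemma cons_coloring0 (n : nat) (a : 'I_N) (g : {ffun 'I_n -> 'I_N}) :
  cons_coloring a g ord0 = a.
Proof. by rewrite ffunE unlift_none. Qed.

Lemma cons_coloringS (n : nat) (a : 'I_N) (g : {ffun 'I_n -> 'I_N}) (i : 'I_n) :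
  cons_coloring a g (lift ord0 i) = g i.
Proof. by rewrite ffunE liftK. Qed.

Lemma proper_coloring_pathP (n : nat) (g : {ffun 'I_n -> 'I_N}) :
  reflect (forall i j : 'I_n, i.+1 = j -> g i != g j)
          (proper_coloring (g : {ffun path_graph n -> 'I_N})).
Proof.
apply: (iffP forallP) => [pg i j ij|pg i].
  by have /forallP/(_ j)/implyP := pg i; apply; rewrite /= /path_edge /= ij eqxx.
apply/forallP => j; apply/implyP => /orP[] /eqP ij; first exact: pg.
by rewrite eq_sym; apply: pg.
Qed.

Lemma proper_coloring_cons (n : nat) (a : 'I_N) (g : {ffun 'I_n.+1 -> 'I_N}) :
  proper_coloring (cons_coloring a g : {ffun path_graph n.+2 -> 'I_N}) =
  (g ord0 != a) && proper_coloring (g : {ffun path_graph n.+1 -> 'I_N}).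
Proof.
apply/proper_coloring_pathP/andP => [pk|[ga /proper_coloring_pathP pg] i j].
  split.
    have := pk ord0 (lift ord0 ord0).
    by rewrite cons_coloring0 cons_coloringS eq_sym; apply.
  apply/proper_coloring_pathP => i j ij.
  by have := pk (lift ord0 i) (lift ord0 j); rewrite !cons_coloringS !lift0 ij; apply.
case: (unliftP ord0 i) => [i'|] ->; case: (unliftP ord0 j) => [j'|] -> //;
  rewrite ?lift0 ?cons_coloring0 ?cons_coloringS // => -[ij]; first exact: pg.
by rewrite eq_sym (_ : j' = ord0) //; apply: val_inj.
Qed.

(** The summand is left arbitrary so that, once the first vertex is deleted, its contribution can be
    absorbed into [F]. *)
Definition path_coloring_sum (n : nat) (a : 'I_N) (F : {ffun 'I_n.+1 -> 'I_N} -> R) :=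
  \sum_(g : {ffun path_graph n.+1 -> 'I_N} | proper_coloring g && (g ord0 == a)) F g.

Lemma path_coloring_sum0 (a : 'I_N) (F : {ffun 'I_1 -> 'I_N} -> R) :
  path_coloring_sum a F = F [ffun=> a].
Proof.
rewrite /path_coloring_sum (big_pred1 [ffun=> a]) // => g /=.
have -> : proper_coloring g.
  by apply/proper_coloring_pathP => i j; rewrite !ord1.
apply/eqP/eqP => [ga|->]; last by rewrite ffunE.
by apply/ffunP => i; rewrite ord1 ffunE.
Qed.

(** Deleting vertex 0 leaves a shorter path, whose colorings are grouped by the color [b] of their
    own first vertex. *)
Lemma path_coloring_sumS (n : nat) (a : 'I_N) (F : {ffun 'I_n.+2 -> 'I_N} -> R) :
  path_coloring_sum a F =
  \sum_(b | b != a) path_coloring_sum b (fun g => F (cons_coloring a g)).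
Proof.
rewrite /path_coloring_sum.
rewrite (reindex_onto (cons_coloring a)
  (fun k : {ffun 'I_n.+2 -> 'I_N} => [ffun i => k (lift ord0 i)])) /=; last first.
  move=> k /andP[_ /eqP ka]; apply/ffunP => i; case: (unliftP ord0 i) => [j|] ->.
    by rewrite cons_coloringS ffunE.
  by rewrite cons_coloring0 ka.
rewrite (partition_big (fun g : {ffun 'I_n.+1 -> 'I_N} => g ord0) (fun b => b != a)) /=.
  apply: eq_bigr => b ba; apply: eq_bigl => g.
  rewrite proper_coloring_cons cons_coloring0 eqxx andbT.
  have -> : [ffun i => cons_coloring a g (lift ord0 i)] = g.
    by apply/ffunP => i; rewrite ffunE cons_coloringS.
  by rewrite eqxx andbT; case: (g ord0 =P b) => [->|]; rewrite ?ba ?andbF.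
by move=> g; rewrite proper_coloring_cons => /andP[/andP[/andP[]]].
Qed.

Lemma prod_cons_coloring (n : nat) (a : 'I_N) (g : {ffun 'I_n -> 'I_N}) :
  \prod_i x (cons_coloring a g i) = x a * \prod_i x (g i).
Proof.
rewrite big_ord_recl cons_coloring0; congr (_ * _).
by apply: eq_bigr => i _; rewrite cons_coloringS.
Qed.

(** [lift ord_max ord_max] is the last vertex but one, so the second factor accounts for the twin of
    the last vertex. *)
Definition end_weight (n : nat) (g : {ffun 'I_n.+2 -> 'I_N}) : R :=
  (\prod_i x (g i)) * avoid_sum (g ord_max) (g (lift ord_max ord_max)).

Lemma end_weight_cons (n : nat) (a : 'I_N) (g : {ffun 'I_n.+2 -> 'I_N}) :
  end_weight (cons_coloring a g) = x a * end_weight g.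
Proof.
rewrite /end_weight prod_cons_coloring -mulrA; congr (_ * (_ * avoid_sum _ _)).
  by rewrite -[RHS](cons_coloringS a); congr (cons_coloring a g _); apply: val_inj.
rewrite -[RHS](cons_coloringS a); congr (cons_coloring a g _); apply: val_inj.
by rewrite /= /bump !ltnn.
Qed.

(** On two vertices, the end vertex, its twin and the vertex colored [a] form a triangle. Each
    further vertex put in front applies [transfer] once. *)
Lemma path_coloring_sum_end_weight (n : nat) (a : 'I_N) :
  path_coloring_sum a (@end_weight n) = x a * iter n (transfer x) (twin_weight x) a.
Proof.
elim: n a => [|n IHn] a; rewrite path_coloring_sumS /= mulr_sumr; apply: eq_bigr => b ba.
  rewrite path_coloring_sum0 /end_weight prod_cons_coloring big_ord1 ffunE mulrA.
  rewrite (_ : ord_max = lift ord0 ord0); last exact: val_inj.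
  rewrite cons_coloringS ffunE (_ : lift _ _ = ord0) ?cons_coloring0 //.
  exact: val_inj.
rewrite -IHn mulr_sumr; apply: eq_bigr => g _; exact: end_weight_cons.
Qed.

Lemma sum_path_twin (n : nat) :
  \sum_(k : {ffun path_twin n.+3 -> 'I_N} | proper_coloring k) \prod_u x (k u) =
  pairing x (twin_weight x) (iter n (transfer x) (twin_weight x)).
Proof.
pose v : path_graph n.+3 := ord0; pose w : twin v := Some ord_max.
transitivity (\sum_(k : {ffun twin w -> 'I_N} | proper_coloring k)
    (\prod_u x (k u)) * 1).
  by apply: eq_bigr => k _; rewrite mulr1.
(* The twin of the last vertex is removed first; the sum over its colors then serves as [F] when the
   twin of the first vertex is removed. *)
rewrite (sum_proper_coloring_twin (fun=> 1)).
rewrite (sum_proper_coloring_twin (fun k : {ffun twin v -> 'I_N} =>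
  \sum_(c | (c != k w) && [forall u, edge w u ==> (c != k u)]) x c * 1)).
transitivity (\sum_(g : {ffun path_graph n.+3 -> 'I_N} | proper_coloring g)
    avoid_sum (g ord0) (g (lift ord0 ord0)) * end_weight g).
  apply: eq_bigr => g _; rewrite /end_weight mulrCA; congr (_ * _).
  rewrite /avoid_sum mulr_suml; apply: eq_big => [b|b _].
    congr (_ && _); apply/forallP/idP => [/(_ (lift ord0 ord0))|bg u].
      by move=> /implyP; apply; rewrite /= /path_edge.
    apply/implyP => vu; have -> // : u = lift ord0 ord0 :> 'I_n.+3.
    by apply: val_inj; move: vu; rewrite /= /path_edge /= orbF => /eqP <-.
  congr (_ * _); apply: eq_big => [c|c _]; rewrite ?mulr1 //.
  rewrite ffunE /=; congr (_ && _); apply/forallP/idP => [|cg u].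
    move=> /(_ (Some (lift ord_max ord_max : 'I_n.+3))); rewrite ffunE.
    by move=> /implyP; apply; rewrite /= /path_edge /= /bump ltnn eqxx orbT.
  (* With at least three vertices the two ends are distinct and not adjacent, so the twin of the
     first vertex puts no constraint on the twin of the last. *)
  apply/implyP; case: u => [u|]; rewrite ffunE //= /path_edge /=.
  move=> wu; have -> // : u = lift ord_max ord_max :> 'I_n.+3.
  apply: val_inj; move: wu (ltn_ord u); rewrite /= /bump ltnn add0n.
  by case/orP=> /eqP; lia.
rewrite (partition_big (fun g : {ffun 'I_n.+3 -> 'I_N} => g ord0) xpredT) //=.
transitivity (\sum_a \sum_(b | b != a)
    x a * avoid_sum a b * path_coloring_sum b (@end_weight n)).
  apply: eq_bigr => a _.
  rewrite -[LHS]/(path_coloring_sum a (fun g =>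
    avoid_sum (g ord0) (g (lift ord0 ord0)) * end_weight g)).
  rewrite path_coloring_sumS; apply: eq_bigr => b _.
  rewrite mulr_sumr; apply: eq_bigr => g /andP[_ /eqP gb].
  by rewrite end_weight_cons cons_coloring0 cons_coloringS gb; ring.
(* For a fixed color [b] of the second vertex, the first vertex and its twin sum to
   [twin_weight x b]. *)
rewrite (exchange_big_dep xpredT) //=; apply: eq_bigr => b _.
rewrite path_coloring_sum_end_weight -mulr_suml mulrCA mulrA; congr (_ * _ * _).
by apply: eq_bigl => a; rewrite eq_sym.
Qed.

End Colorings.

(** * The recursion on partitions for the coefficients of path sums *)

(** [k] is fuel, one unit per part. The term [size s == 1] comes from the lone e_n, and [undup]
    makes each part size be removed once, whatever its multiplicity. *)
Fixpoint path_coef_rec (k : nat) (s : seq nat) : int :=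
  if k is k'.+1 then
    (size s == 1)%:R + \sum_(i <- undup s) (i%:Z - 1) * path_coef_rec k' (rem i s)
  else 1.

(* The coefficient of e_s in X_(P_n), for n = sumn s; see path_sum_expansion. *)
Definition path_coef (s : seq nat) : int := path_coef_rec (size s) s.

(** The index list is free, so that it can be an interval in the induction on degree and a short
    explicit list for concrete shapes. *)
Lemma path_coefE (r s : seq nat) : s != [::] -> uniq r -> {subset s <= r} ->
  path_coef s =
  (size s == 1)%:R + \sum_(i <- r | i \in s) (i%:Z - 1) * path_coef (rem i s).
Proof.
move=> s0 ur sr; have /prednK sk : (0 < size s)%N by rewrite lt0n size_eq0.
rewrite {1}/path_coef -{1}sk /=; congr (_ + _).
rewrite -[RHS]big_filter (@perm_big _ _ _ _ _ [seq i <- r | i \in s]) /=.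
  rewrite !big_filter; apply: eq_bigr => i is_.
  by rewrite /path_coef size_rem.
apply: uniq_perm; rewrite ?undup_uniq ?filter_uniq // => i.
rewrite mem_undup mem_filter; case: (boolP (i \in s)) => //= is_.
by rewrite sr.
Qed.

Lemma sumn_rem (i : nat) (s : seq nat) : i \in s -> sumn s = (i + sumn (rem i s))%N.
Proof. by move=> is_; rewrite (perm_sumn (perm_to_rem is_)). Qed.

(** * Path sums as polynomials in the elementary symmetric polynomials *)

Section Monomials.
Variable N : nat.

(** The exponent vector of e_s when the variable of index [i] stands for e_(i+1); entries of [s]
    outside 1..N leave no trace. *)
Definition part_mnm (s : seq nat) : 'X_{1..N} :=
  [multinom count_mem i.+1 s | i < N].

Lemma part_mnm0 : part_mnm [::] = 0%MM.
Proof. by apply/mnmP => i; rewrite !mnmE. Qed.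

Lemma part_mnm_perm (s t : seq nat) : perm_eq s t -> part_mnm s = part_mnm t.
Proof. by move=> /permP st; apply/mnmP => i; rewrite !mnmE st. Qed.

Lemma part_mnm_inj (s t : seq nat) :
  all (fun i => 0 < i <= N)%N s -> all (fun i => 0 < i <= N)%N t ->
  part_mnm s = part_mnm t -> perm_eq s t.
Proof.
move=> sN tN /mnmP st; apply/allP => -[|i] ist; apply/eqP.
  have nz u : all (fun i => 0 < i <= N)%N u -> 0%N \notin u.
    by move=> /allP uN; apply/negP => /uN.
  by rewrite !(count_memPn (nz _ _)).
have iN : (i < N)%N.
  by move: ist; rewrite mem_cat => /orP[/(allP sN)|/(allP tN)].
by have := st (Ordinal iN); rewrite !mnmE.
Qed.

Lemma part_mnm_rem (i : 'I_N) (s : seq nat) : i.+1 \in s ->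
  part_mnm s = (U_(i) + part_mnm (rem i.+1 s))%MM.
Proof.
move=> is_; rewrite (part_mnm_perm (perm_to_rem is_)).
by apply/mnmP => j; rewrite mnmDE !mnmE /= eqSS.
Qed.

Lemma mcoeff_part_mnm_XM (i : 'I_N) (q : {mpoly int[N]}) (s : seq nat) :
  ('X_i * q)@_(part_mnm s) =
  if i.+1 \in s then q@_(part_mnm (rem i.+1 s)) else 0.
Proof.
case: ifP => [is_|/negbT is_]; first by rewrite (part_mnm_rem is_) mulrC mcoeffMX.
apply/eqP; rewrite mcoeff_eq0; apply/negP => /msuppM_le /allpairsP[[m1 m2]].
rewrite msuppX inE => -[/eqP /= -> _ /mnmP /(_ i)].
by rewrite mnmDE !mnmE eqxx (count_memPn is_).
Qed.

Local Notation S := [tuple mesym N int i.+1 | i < N].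

Lemma comp_part_mnm (s : seq nat) : all (fun i => 0 < i <= N)%N s ->
  'X_[part_mnm s] \mPo S = \prod_(i <- s) mesym N int i.
Proof.
elim: s => [|[|i] s IHs] //= => [_|/andP[iN sN]].
  by rewrite big_nil part_mnm0 mpolyX0 rmorph1.
rewrite (@part_mnm_rem (Ordinal iN)) ?mem_head //= eqxx mpolyXD rmorphM /=.
by rewrite IHs // big_cons comp_mpolyXU -tnth_nth tnth_mktuple.
Qed.

Local Notation W := (path_sum (fun i : 'I_N => 'X_i : {mpoly int[N]})).

Lemma coef_elem_gf_mesym (k : nat) :
  (elem_gf (fun i : 'I_N => 'X_i : {mpoly int[N]}))`_k = mesym N int k.
Proof.
rewrite /elem_gf; under eq_bigr do rewrite addrC.
rewrite bigA_distr coef_sum [RHS]big_mkcond; apply: eq_bigr => h _ /=.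
rewrite -big_mkcond /= scaler_prod prodr_const coefZ coefXn mulr_natr eq_sym.
by case: eqP.
Qed.

(** The term of index 0 in [elem_gf_path_sum] is [W n.+1]; the others change sides. After the shift,
    index [i] stands for the part i+1, hence the weight [i]. *)
Lemma path_sumS (n : nat) :
  W n.+1 = mesym N int n.+1 + \sum_(i < n.+1) i%:R * (mesym N int i.+1 * W (n - i)).
Proof.
rewrite -[mesym N int n.+1 in RHS]coef_elem_gf_mesym -elem_gf_path_sum big_ord_recl.
rewrite subr0 coef_elem_gf_mesym mesym0E !mul1r subn0 -addrA -big_split big1 ?addr0 //.
move=> i _; rewrite coef_elem_gf_mesym lift0 subSS /=.
by rewrite mulrS; ring.
Qed.

Lemma path_sum_expansion (n : nat) : (n <= N)%N ->
  exists2 q : {mpoly int[N]}, q \mPo S = W n &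
  forall s, 0%N \notin s -> sumn s = n -> q@_(part_mnm s) = path_coef s.
Proof.
elim/ltn_ind: n => -[_ _|n IHn nN].
  exists 1 => [|s s0 /eqP]; first exact: comp_mpoly1.
  rewrite mcoeff1; case: s s0 => [|[|i] s] // _ _.
  by rewrite part_mnm0 eqxx.
have /fin_all_exists2[q qW qc] (i : 'I_n.+1) : exists2 q : {mpoly int[N]},
    q \mPo S = W (n - i) &
    forall s, 0%N \notin s -> sumn s = (n - i)%N -> q@_(part_mnm s) = path_coef s.
  by apply: IHn; rewrite ?ltnS ?leq_subr // (leq_trans _ nN) // leqW ?leq_subr.
pose y (i : 'I_n.+1) : {mpoly int[N]} := 'X_(widen_ord nN i).
have yS i : y i \mPo S = mesym N int i.+1.
  by rewrite /y comp_mpolyXU -tnth_nth tnth_mktuple.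
(* The witness copies [path_sumS], with variables in place of the elementary polynomials. *)
exists (y ord_max * 1 + \sum_(i < n.+1) i%:R *: (y i * q i)) => [|s s0 sn].
  rewrite path_sumS raddfD mulr1 /= yS raddf_sum; congr (_ + _); apply: eq_bigr => i _.
  by rewrite /= comp_mpolyZ rmorphM /= yS qW scaler_nat mulr_natl.
have s_neq0 : s != [::] by apply: contra_eq_neq sn => ->.
have s_iota : {subset s <= iota 1 n.+1}.
  move=> i is_; rewrite mem_iota add1n ltnS -sn (sumn_rem is_) leq_addr andbT.
  by rewrite lt0n; apply: contraNneq s0 => <-.
rewrite (path_coefE s_neq0 (iota_uniq _ _) s_iota) mcoeffD raddf_sum.
congr (_ + _).
  rewrite mcoeff_part_mnm_XM /=; case: ifP => [ns|/negbT ns].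
    (* A part equal to the whole sum is the only part, since no part is 0; this is where the term
       [size s == 1] comes from. *)
    have rem0 : rem n.+1 s = [::].
      have: 0%N \notin rem n.+1 s by apply: contra s0; apply: mem_rem.
      have /eqP := sumn_rem ns; rewrite sn -{1}[n.+1]addn0 eqn_add2l eq_sym.
      by case: (rem n.+1 s) => // -[|a] t.
    by rewrite rem0 part_mnm0 mcoeff1 eqxx (perm_size (perm_to_rem ns)) rem0.
  case: eqP => // size_s; case: s size_s ns sn {s0 s_neq0 s_iota} => [|a []] //= _.
  by rewrite addn0 inE => /eqP na an; case: na.
rewrite -[1%N]addn0 iotaDl big_map -val_enum_ord big_map big_enum_cond /= [RHS]big_mkcond.
apply: eq_bigr => i _; rewrite /= mcoeffZ mcoeff_part_mnm_XM add1n /=.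
case: ifP => [is_|_]; last by rewrite mulr0.
rewrite qc.
- congr (_ * _).
  by rewrite intS addrAC subrr add0r natz.
- by apply: contra s0; apply: mem_rem.
- by apply/eqP; rewrite -(eqn_add2l i.+1) -sumn_rem // sn addSn subnKC // -ltnS.
Qed.

End Monomials.

(** * Comparing coefficients for the twinned paths *)

(** The effect on coefficients of multiplying by e_2. *)
Definition drop2_coef (p : seq nat -> int) (s : seq nat) : int :=
  if 2%N \in s then p (rem 2%N s) else 0.

Lemma intpart_bounds (l : intpart) : all (fun i => 0 < i <= sumn l)%N l.
Proof.
apply/allP => i il; rewrite (sumn_rem il) leq_addr andbT lt0n.
by apply: contraTneq il => ->; case: l => l /= /andP[].
Qed.

(** Partitions of [m] have parts at most [m], so [m] variables tell their exponent vectors apart and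
    a single term survives. *)
Lemma mcoeff_e_expansion (m : nat) (c : intpart -> int) (s : seq nat) :
  0%N \notin s -> sumn s = m ->
  (\sum_(l <- intparts m) c l *: 'X_[part_mnm m l])@_(part_mnm m s) =
  c (mkintpart s).
Proof.
move=> s0 sm; have s_perm := perm_mkintpart s0.
have inm (l : intpart) : sumn l = m -> all (fun i => 0 < i <= m)%N l.
  by move=> <-; apply: intpart_bounds.
have s_in : mkintpart s \in intparts m by rewrite mem_intparts (perm_sumn s_perm) sm.
rewrite raddf_sum (bigD1_seq _ s_in) ?uniq_intparts //= mcoeffZ mcoeffX.
rewrite (part_mnm_perm _ s_perm) eqxx mulr1 big_seq_cond big1 ?addr0 //.
move=> l /andP[]; rewrite mem_intparts => /eqP lm l_neq.
rewrite mcoeffZ mcoeffX; case: eqP => [l_s|]; last by rewrite mulr0.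
case/negP: l_neq; apply/eqP/val_inj.
apply: (@sorted_eq _ geq).
- by move=> x y z /= yx xz; apply: leq_trans xz yx.
- by move=> x y; rewrite -eqn_leq => /eqP.
- by case: l {lm l_s} => l /= /andP[].
- by have /andP[] := mkintpart_subproof s.
apply: (@part_mnm_inj m); rewrite ?inm //; first by rewrite (perm_sumn s_perm).
by rewrite l_s (part_mnm_perm _ s_perm).
Qed.

Lemma comp_e_expansion (m : nat) (c : intpart -> int) :
  (\sum_(l <- intparts m) c l *: 'X_[part_mnm m l])
    \mPo [tuple mesym m int i.+1 | i < m] =
  \sum_(l <- intparts m) c l *: elem_symfun l m.
Proof.
rewrite raddf_sum /= !big_seq; apply: eq_bigr => l; rewrite mem_intparts => /eqP lm.
by rewrite comp_mpolyZ comp_part_mnm // -lm; apply: intpart_bounds.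
Qed.

Lemma chromatic_path_twin (n N : nat)
    (W := path_sum (fun i : 'I_N => 'X_i : {mpoly int[N]})) :
  chromatic_symfun (path_twin n.+3) N =
  4 * W n.+4.+1 - 8 * (mesym N int 2 * W n.+3)
    + 4 * (mesym N int 2 * (mesym N int 2 * W n.+1)).
Proof.
have W2 : W 2 = 2 * mesym N int 2.
  rewrite /W path_sumS big_ord_recl big_ord1 mul0r add0r lift0 mul1r subnn mulr1.
  by rewrite mulr_natl mulr2n.
rewrite /chromatic_symfun (sum_path_twin (fun i : 'I_N => 'X_i : {mpoly int[N]})).
by rewrite pairing_twin_weight -/W W2; ring.
Qed.

(** In [sumn s] variables the elementary polynomials are algebraically independent, so both
    expansions agree coefficient by coefficient. The factors 8 and 4 come from W_2 = 2 e_2. *)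
Lemma path_twin_coef (c : intpart -> int) (s : seq nat) :
  e_expansion path_twin_gf c -> 0%N \notin s ->
  c (mkintpart s) = if (5 <= sumn s)%N then
    4 * path_coef s - 8 * drop2_coef path_coef s
      + 4 * drop2_coef (drop2_coef path_coef) s
  else 0.
Proof.
move=> hc s0; rewrite -(mcoeff_e_expansion c s0 (erefl _)).
have := hc (sumn s) (sumn s); rewrite -comp_e_expansion /path_twin_gf.
have rem0 i (t : seq nat) : 0%N \notin t -> 0%N \notin rem i t.
  by apply: contra; apply: mem_rem.
(* Below degree 5 the series has no term, and independence makes the coefficients vanish. *)
case: ifP => [sz|_ /esym q0]; last by rewrite (msym_fundamental_un0 q0) mcoeff0.
have [n sn] : exists n, sumn s = n.+4.+1 by exists (sumn s - 5)%N; lia.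
rewrite -[LHS]/(chromatic_symfun _ _) (_ : (sumn s - 2 = n.+3)%N); last by lia.
have /path_sum_expansion[q0 q0W q0c] : (n.+4.+1 <= sumn s)%N by lia.
have /path_sum_expansion[q1 q1W q1c] : (n.+3 <= sumn s)%N by lia.
have /path_sum_expansion[q2 q2W q2c] : (n.+1 <= sumn s)%N by lia.
have h2 : (1 < sumn s)%N by lia.
rewrite chromatic_path_twin -q0W -q1W -q2W.
have <- : 'X_(Ordinal h2) \mPo [tuple mesym (sumn s) int i.+1 | i < sumn s] =
  mesym (sumn s) int 2 by rewrite comp_mpolyXU -tnth_nth tnth_mktuple.
set y := 'X_(Ordinal h2).
rewrite !mulr_natl -!rmorphM.
set S := [tuple mesym (sumn s) int i.+1 | i < sumn s].
have qS : (q0 *+ 4 - (y * q1) *+ 8 + (y * (y * q2)) *+ 4) \mPo S =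
    (q0 \mPo S) *+ 4 - ((y * q1) \mPo S) *+ 8 + ((y * (y * q2)) \mPo S) *+ 4.
  by rewrite comp_mpolyD comp_mpolyB !comp_mpolyMn.
move=> twin_q; have /msym_fundamental_un <- := etrans qS twin_q.
rewrite mcoeffD mcoeffB !mcoeffMn !mcoeff_part_mnm_XM /= q0c // /drop2_coef.
case: ifP => [s2|_] //.
rewrite q1c ?rem0 //; last by have := sumn_rem s2; lia.
case: ifP => [s22|_] //.
rewrite q2c ?rem0 //; by have := sumn_rem s2; have := sumn_rem s22; lia.
Qed.

(** * Explicit path coefficients *)

(** Removing a 1 has weight 0, and removing any other part leaves both 1s in place. *)
Lemma path_coef_two1 (s : seq nat) : (1 < count_mem 1%N s)%N -> path_coef s = 0.
Proof.
move: {2}(size s) (erefl (size s)) => k; elim: k s => [|k IHk] s sk s1.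
  by case: s sk s1.
rewrite (@path_coefE (undup s)) ?undup_uniq //; last 2 first.
- by case: s {IHk sk} s1.
- by move=> i; rewrite mem_undup.
rewrite big1 ?addr0 => [|i is_].
  by rewrite (gtn_eqF (leq_trans s1 (count_size _ _))).
have [->|i1] := eqVneq i 1%N; first by rewrite subrr mul0r.
rewrite IHk ?mulr0 ?size_rem ?sk //.
by have := permP (perm_to_rem is_) (pred1 1%N); rewrite /= (negPf i1) add0n => <-.
Qed.

Lemma path_coef0 : path_coef [::] = 1.
Proof. by []. Qed.

Lemma path_coef1 (i : nat) : path_coef [:: i] = i%:Z.
Proof.
rewrite (@path_coefE [:: i]) // big_cons big_nil mem_head /= eqxx path_coef0.
by ring.
Qed.

Lemma path_coef_diag (i : nat) : path_coef [:: i; i] = i%:Z * (i%:Z - 1).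
Proof.
rewrite (@path_coefE [:: i]) //; last by move=> j; rewrite !inE orbb.
rewrite big_cons big_nil mem_head /= eqxx path_coef1.
by ring.
Qed.

Lemma path_coef2 (i j : nat) : i != j ->
  path_coef [:: i; j] = (i%:Z - 1) * j%:Z + (j%:Z - 1) * i%:Z.
Proof.
move=> ij; rewrite (@path_coefE [:: i; j]) //=; last by rewrite inE ij.
by rewrite !big_cons big_nil !inE !eqxx orbT /= (negPf ij) !path_coef1; ring.
Qed.

Lemma path_coef_diag1 (i : nat) : i != 1%N ->
  path_coef [:: i; i; 1%N] = (i%:Z - 1) ^+ 2.
Proof.
move=> i1; rewrite (@path_coefE [:: i; 1%N]) /= ?inE ?i1 //; last first.
  by move=> j; rewrite !inE orbA orbb.
rewrite !big_cons big_nil !inE !eqxx !orbT /= (path_coef2 i1); ring.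
Qed.

Lemma path_coef21 (i j : nat) : i != 1%N -> j != 1%N -> i != j ->
  path_coef [:: i; j; 1%N] = 2 * (i%:Z - 1) * (j%:Z - 1).
Proof.
move=> i1 j1 ij; rewrite (@path_coefE [:: i; j; 1%N]) //= ?inE ?negb_or ?i1 ?j1 ?ij //.
rewrite !big_cons big_nil !inE !eqxx !orbT /= (negPf ij) !path_coef2 //; ring.
Qed.

Lemma path_coef_nseq2 (k : nat) : path_coef (nseq k.+1 2%N) = 2.
Proof.
elim: k => [|k IHk]; first exact: path_coef1.
rewrite (@path_coefE [:: 2%N]) //; last by apply/allP; rewrite /= ?all_cat all_nseq /= orbT.
by rewrite big_cons big_nil /= IHk.
Qed.

Lemma path_coef_3nseq2 (k : nat) : path_coef (3%N :: nseq k 2%N) = 4 * k%:Z + 3.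
Proof.
elim: k => [|k IHk]; first exact: path_coef1.
rewrite (@path_coefE [:: 3; 2]%N) //; last first.
  by apply/allP; rewrite /= ?all_cat all_nseq /= orbT.
by rewrite !big_cons big_nil !inE eqxx /= IHk path_coef_nseq2 intS; ring.
Qed.

(** Removing a 2 has weight 1 and removing a 3 has weight 2, so the increment from [k] to k+1 is
    twice the linear value of [path_coef_3nseq2] at k+1. *)
Lemma path_coef_33nseq2 (k : nat) :
  path_coef [:: 3, 3 & nseq k 2]%N = 4 * (k%:Z + 1) ^+ 2 + 2 * (k%:Z + 1).
Proof.
elim: k => [|k IHk]; first by rewrite path_coef_diag.
rewrite (@path_coefE [:: 3; 2]%N) //; last first.
  by apply/allP; rewrite /= ?all_cat all_nseq /= orbT.
by rewrite !big_cons big_nil !inE eqxx /= IHk (path_coef_3nseq2 k.+1) intS; ring.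
Qed.

(** The 1 is removed with weight 0, so only the chain that removes every 2 and ends in the lone e_1
    contributes. *)
Lemma path_coef_nseq21 (k : nat) : path_coef (nseq k 2 ++ [:: 1])%N = 1.
Proof.
elim: k => [|k IHk]; first exact: path_coef1.
rewrite (@path_coefE [:: 2; 1]%N) //; last first.
  by apply/allP; rewrite /= ?all_cat all_nseq /= orbT.
rewrite !big_cons big_nil !inE !mem_cat !inE eqxx !orbT /= IHk subrr mul0r.
by rewrite size_cat addn1.
Qed.

Lemma path_coef_3nseq21 (k : nat) :
  path_coef (3 :: nseq k 2 ++ [:: 1])%N = 2 * (k%:Z + 1).
Proof.
elim: k => [|k IHk]; first by rewrite path_coef2.
rewrite (@path_coefE [:: 3; 2; 1]%N) //; last first.
  by apply/allP; rewrite /= ?all_cat all_nseq /= orbT.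
rewrite !big_cons big_nil !inE !mem_cat !inE eqxx !orbT /= IHk.
rewrite (path_coef_nseq21 k.+1) intS; ring.
Qed.

Lemma path_coef_33nseq21 (k : nat) :
  path_coef ([:: 3, 3 & nseq k 2 ++ [:: 1]])%N = 2 * (k%:Z + 1) * (k%:Z + 2).
Proof.
elim: k => [|k IHk]; first by rewrite path_coef_diag1.
rewrite (@path_coefE [:: 3; 2; 1]%N) //; last first.
  by apply/allP; rewrite /= ?all_cat all_nseq /= orbT.
rewrite !big_cons big_nil !inE !mem_cat !inE eqxx !orbT /= IHk.
rewrite (path_coef_3nseq21 k.+1) intS; ring.
Qed.

Theorem corollary3p15 (c : intpart -> int) (hc : e_expansion path_twin_gf c) :
  (forall k : nat, (3 <= k)%N ->
    [/\ c (mkintpart [:: k + 2]%N) = 4 * (k%:Z + 2),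
        c (mkintpart [:: k; 2]%N) = 4 * (k%:Z - 2)
      & c (mkintpart [:: k + 1; 1]%N) = 4 * k%:Z]) /\
  (forall i : nat, (3 <= i)%N ->
    c (mkintpart [:: i; i]) = 4 * (i%:Z - 1) * i%:Z) /\
  (forall i j : nat, (3 <= i)%N -> (3 <= j)%N -> i <> j ->
    c (mkintpart [:: i; j]) = 4 * (j%:Z - 1) * i%:Z + 4 * (i%:Z - 1) * j%:Z) /\
  (forall i : nat, (3 <= i)%N ->
    c (mkintpart [:: i; i; 1]%N) = 4 * (i%:Z - 1) ^+ 2) /\
  (forall i j : nat, (3 <= i)%N -> (3 <= j)%N -> i <> j ->
    c (mkintpart [:: i; j; 1]%N) = 8 * (i%:Z - 1) * (j%:Z - 1)) /\
  (forall i j : nat, (1 <= i)%N -> (1 <= j)%N -> (minn i j <= 2)%N ->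
    c (mkintpart [:: i; j; 1]%N) = 0) /\
  (forall mu : intpart, c (mkintpart (1%N :: mu)) <> 0 -> 1%N \notin parts mu) /\
  (forall k : nat,
    c (mkintpart ([:: 3; 3] ++ nseq k.+1 2)%N) = 32 /\
    c (mkintpart ([:: 3; 3] ++ nseq k.+1 2 ++ [:: 1])%N) = 16).
Proof.
have drop2_two1 (p : seq nat -> int) :
    (forall t, (1 < count_mem 1%N t)%N -> p t = 0) ->
    forall t, (1 < count_mem 1%N t)%N -> drop2_coef p t = 0.
  move=> p0 t t1; rewrite /drop2_coef; case: ifP => // t2; apply: p0.
  by have := permP (perm_to_rem t2) (pred1 1%N); rewrite /= add0n => <-.
have two1 s : 0%N \notin s -> (1 < count_mem 1%N s)%N -> c (mkintpart s) = 0.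
  move=> s0 s1; have p0 := path_coef_two1; have dp0 := drop2_two1 _ p0.
  rewrite (path_twin_coef hc s0) p0 // dp0 // (drop2_two1 _ dp0) //.
  by rewrite !mulr0 subr0 addr0 if_same.
have ge3E i : (3 <= i)%N -> ((0%N == i) = false) * ((i == 1%N) = false) *
    ((2%N == i) = false) * ((i == 2%N) = false).
  by move=> i3; do !split; apply/negbTE; lia.
split; [move=> k k3; split | do ![split]].
- have k2 : (3 <= k + 2)%N by lia.
  rewrite (path_twin_coef hc) ?inE ?(ge3E _ k2) //= ifT ?addn0; last by lia.
  by rewrite /drop2_coef inE (ge3E _ k2) // path_coef1 PoszD; ring.
- rewrite (path_twin_coef hc) ?inE ?(ge3E _ k3) //= ifT; last by lia.
  rewrite /drop2_coef /= !inE !(ge3E _ k3) //= inE (ge3E _ k3) //.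
  by rewrite path_coef2 ?(ge3E _ k3) // path_coef1; ring.
- have k1 : (3 <= k + 1)%N by lia.
  rewrite (path_twin_coef hc) ?inE ?(ge3E _ k1) //= ifT; last by lia.
  by rewrite /drop2_coef !inE (ge3E _ k1) //= path_coef2 ?(ge3E _ k1) // PoszD; ring.
- move=> i i3; rewrite (path_twin_coef hc) ?inE ?(ge3E _ i3) //= ifT; last by lia.
  by rewrite /drop2_coef !inE !(ge3E _ i3) // path_coef_diag; ring.
- move=> i j i3 j3 /eqP ij.
  rewrite (path_twin_coef hc) ?inE ?(ge3E _ i3, ge3E _ j3) //= ifT; last by lia.
  by rewrite /drop2_coef !inE !(ge3E _ i3, ge3E _ j3) // path_coef2 //; ring.
- move=> i i3; rewrite (path_twin_coef hc) ?inE ?(ge3E _ i3) //= ifT; last by lia.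
  by rewrite /drop2_coef !inE !(ge3E _ i3) // path_coef_diag1 ?(ge3E _ i3) //; ring.
- move=> i j i3 j3 /eqP ij.
  rewrite (path_twin_coef hc) ?inE ?(ge3E _ i3, ge3E _ j3) //= ifT; last by lia.
  rewrite /drop2_coef !inE !(ge3E _ i3, ge3E _ j3) //=.
  by rewrite path_coef21 ?(ge3E _ i3, ge3E _ j3) //; ring.
- move=> i j i1 j1 ij2.
  have ij0 : 0%N \notin [:: i; j; 1%N] by rewrite !inE; lia.
  have [i_1|i_n1] := eqVneq i 1%N; first by rewrite two1 // i_1 /=; lia.
  have [j_1|j_n1] := eqVneq j 1%N; first by rewrite two1 // j_1 /=; lia.
  rewrite (path_twin_coef hc) //= ifT; last by lia.
  (* Dropping 2s cancels everything: 4 - 8 + 4 when both parts are 2, and 8 (j - 1) - 8 (j - 1) when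
     only one is, the other being [j]. *)
  have [i_2|i_n2] := eqVneq i 2%N; have [j_2|j_n2] := eqVneq j 2%N; last by lia.
  + rewrite i_2 j_2 /drop2_coef /= path_coef_diag1 // path_coef2 // path_coef1.
    by ring.
  + rewrite i_2 /drop2_coef !inE eqxx (eq_sym 2%N j) (negPf j_n2) /=.
    by rewrite path_coef21 // 1?eq_sym // path_coef2 //; ring.
  + rewrite j_2 /drop2_coef !inE eqxx orbT /= (negPf i_n2) !inE.
    by rewrite (eq_sym 2%N i) (negPf i_n2) /= path_coef21 // path_coef2 //; ring.
- move=> mu cmu; apply/negP => mu1; apply: cmu; apply: two1.
    by case: mu {mu1} => mu /= /andP[_]; rewrite inE.
  by rewrite /= add1n ltnS -has_count has_pred1.
- rewrite (path_twin_coef hc) /=; last by rewrite !inE mem_nseq andbF.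
  rewrite /drop2_coef /=.
  (* The coefficient is 4 times a second difference of the quadratic in [path_coef_33nseq2], namely
     4 * 8. For [k = 0] the second drop gives 0, in accord with the quadratic vanishing at -1. *)
  case: k => [|k].
    by rewrite (path_coef_33nseq2 1) (path_coef_33nseq2 0).
  rewrite /= (path_coef_33nseq2 k.+2) (path_coef_33nseq2 k.+1) path_coef_33nseq2.
  by rewrite !intS; ring.
- rewrite (path_twin_coef hc) /=; last by rewrite !inE mem_cat mem_nseq andbF.
  rewrite /drop2_coef /=.
  (* Again 4 times a second difference, here 4 * 4, and 2 (k + 1) (k + 2) also vanishes at -1. *)
  case: k => [|k].
    by rewrite (path_coef_33nseq21 1) (path_coef_33nseq21 0).
  rewrite /= (path_coef_33nseq21 k.+2) (path_coef_33nseq21 k.+1) path_coef_33nseq21.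
  by rewrite !intS; ring.
Qed.
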